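(* Let $\{\lambda^n\}_{n\geq0}$ be a graded partition sequence and for each $n\geq0$ put $u_n=m_{\lambda^n}$. Then the set $\{u_n\}_{n\geq0}$ is algebraically independent over $\mathbb Z$ and generates $\Lambda_{\mathbb Z}$ as a $\mathbb Z$-algebra if and only if, for each $n\geq0$, $\lambda^n=(1^n)$.
   Context: $\Lambda_{\mathbb Z}$ is the ring of symmetric functions in infinitely many variables with integer coefficients, and $m_\lambda$ is the monomial symmetric function. A graded partition sequence is a sequence $\{\lambda^n\}_{n\ge0}$ with $\lambda^n$ a partition of $n$ for each $n$. $(1^n)$ denotes the partition with $n$ parts equal to $1$.
   Formalization: Since u_0 = 1 is a root of X − 1, the set {u_n}_{n≥0} is never algebraically independent; the formal statement requires algebraic independence only of {u_n}_{n≥1}, while generation and the condition λ^n = (1^n) are kept for all n ≥ 0. *)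

(* Defs.v *)
From HB Require Import structures.
From mathcomp Require Import all_boot all_order all_fingroup all_algebra.
From mathcomp Require Import boolp classical_sets.
From mathcomp Require Export mpoly.

Set Implicit Arguments.
Unset Strict Implicit.
Unset Printing Implicit Defensive.

Import GRing.Theory.
Local Open Scope ring_scope.

Definition is_partition (n : nat) (la : seq nat) : bool :=
  [&& sorted geq la, 0%N \notin la & sumn la == n].

Definition graded_partition_sequence (la : nat -> seq nat) : Prop :=
  forall n, is_partition n (la n).

(* The substitution x_{n+1} := 0. *)
Definition zero_last (n : nat) (p : {mpoly int[n.+1]}) : {mpoly int[n]} :=
  p \mPo [tuple (if unlift ord_max i is Some j then 'X_j else 0) | i < n.+1].

(* The ring of symmetric functions is the limit, in the category of graded
   rings, of the rings of symmetric polynomials in n variables along the maps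
   [zero_last].  An element is the compatible family of its truncations to the
   first n variables; the limit being taken among graded rings, the degrees of
   these truncations are bounded independently of n. *)
Definition is_symfun (f : forall n, {mpoly int[n]}) : Prop :=
  [/\ forall n, f n \is symmetric,
      forall n, zero_last (f n.+1) = f n
    & exists d, forall n, (msize (f n) <= d)%N].

Record symfun := SymFun {
  trunc :> forall n, {mpoly int[n]};
  truncP : is_symfun trunc
}.

Lemma symfunP (f g : symfun) : (forall n, f n = g n) -> f = g.
Proof.
case: f g => [f hf] [g hg] /= fg.
have {}fg : f = g by apply: functional_extensionality_dep.
by case: _ / fg in hg *; congr SymFun; apply: Prop_irrelevance.
Qed.

HB.instance Definition _ := gen_eqMixin symfun.
HB.instance Definition _ := gen_choiceMixin symfun.

Section SymFunRing.

Fact symfunC_subproof (c : int) : is_symfun (fun n => c%:MP_[n]).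
Proof.
split=> [n|n|]; first by apply/issymP=> s; rewrite /msym mmapC.
  exact: comp_mpolyC.
by exists 1%N => n; rewrite mmeasureC; case: (c == 0).
Qed.

Fact symfun_opp_subproof (f : symfun) : is_symfun (fun n => - f n).
Proof.
case: f => f [/= fs fz [d fd]]; split=> [n|n|]; first by rewrite rpredN /=.
  by rewrite /= -[in RHS]fz; apply: comp_mpolyN.
by exists d => n; rewrite mmeasureN.
Qed.

Fact symfun_add_subproof (f g : symfun) : is_symfun (fun n => f n + g n).
Proof.
case: f g => f [/= fs fz [d fd]] [g [/= gs gz [e ge]]]; split=> [n|n|].
- by rewrite rpredD /=.
- by rewrite /= -[in RHS]fz -[in RHS]gz; apply: comp_mpolyD.
exists (maxn d e) => n; apply: leq_trans (msizeD_le _ _) _.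
by rewrite geq_max !leq_max fd ge orbT.
Qed.

Fact symfun_mul_subproof (f g : symfun) : is_symfun (fun n => f n * g n).
Proof.
case: f g => f [/= fs fz [d fd]] [g [/= gs gz [e ge]]]; split=> [n|n|].
- by rewrite rpredM /=.
- by rewrite /= -[in RHS]fz -[in RHS]gz; apply: rmorphM.
exists (d + e)%N => n.
have [->|f0] := eqVneq (f n) 0; first by rewrite mul0r mmeasure0.
have [->|g0] := eqVneq (g n) 0; first by rewrite mulr0 mmeasure0.
by rewrite msizeM // (leq_trans (leq_pred _)) // leq_add.
Qed.

Definition symfunC c := SymFun (symfunC_subproof c).
Definition symfun_opp f := SymFun (symfun_opp_subproof f).
Definition symfun_add f g := SymFun (symfun_add_subproof f g).
Definition symfun_mul f g := SymFun (symfun_mul_subproof f g).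

Fact symfun_addA : associative symfun_add.
Proof. by move=> f g h; apply: symfunP => n; apply: addrA. Qed.
Fact symfun_addC : commutative symfun_add.
Proof. by move=> f g; apply: symfunP => n; apply: addrC. Qed.
Fact symfun_add0 : left_id (symfunC 0) symfun_add.
Proof. by move=> f; apply: symfunP => n /=; rewrite mpolyC0 add0r. Qed.
Fact symfun_addN : left_inverse (symfunC 0) symfun_opp symfun_add.
Proof. by move=> f; apply: symfunP => n /=; rewrite mpolyC0 addNr. Qed.

HB.instance Definition _ := GRing.isZmodule.Build symfun
  symfun_addA symfun_addC symfun_add0 symfun_addN.

Fact symfun_mulA : associative symfun_mul.
Proof. by move=> f g h; apply: symfunP => n; apply: mulrA. Qed.
Fact symfun_mulC : commutative symfun_mul.
Proof. by move=> f g; apply: symfunP => n; apply: mulrC. Qed.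
Fact symfun_mul1 : left_id (symfunC 1) symfun_mul.
Proof. by move=> f; apply: symfunP => n /=; rewrite mpolyC1 mul1r. Qed.
Fact symfun_mulD : left_distributive symfun_mul symfun_add.
Proof. by move=> f g h; apply: symfunP => n; apply: mulrDl. Qed.
Fact symfun_1neq0 : symfunC 1 != 0.
Proof.
apply/eqP => /(congr1 (fun f : symfun => f 0%N)) /= /eqP.
by rewrite mpolyC1 mpolyC0 oner_eq0.
Qed.

HB.instance Definition _ := GRing.Zmodule_isComNzRing.Build symfun
  symfun_mulA symfun_mulC symfun_mul1 symfun_mulD symfun_1neq0.

End SymFunRing.

(* The sum of the distinct monomials in n variables whose nonzero exponents are
   the parts of [la] in some order.  The degree bound only makes the index type
   finite: all these monomials have degree [sumn la]. *)
Definition monomial_sympoly (la : seq nat) (n : nat) : {mpoly int[n]} :=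
  \sum_(m : 'X_{1..n < (sumn la).+1} |
      perm_eq [seq i <- (m : 'X_{1..n}) | i != 0%N] la) 'X_[m].

Lemma mcoeff_monomial_sympoly (la : seq nat) (n : nat) (m : 'X_{1..n}) :
  (monomial_sympoly la n)@_m
    = (perm_eq [seq i <- m | i != 0%N] la)%:R.
Proof.
rewrite /monomial_sympoly raddf_sum /=.
case: (boolP (perm_eq _ la)) => [mla|/negP mla]; last first.
  rewrite big1 // => k kla; rewrite mcoeffX.
  by case: eqP => // km; rewrite -km kla in mla.
have mdeg_lt : (mdeg m < (sumn la).+1)%N.
  rewrite ltnS -(perm_sumn mla) sumnE big_filter /mdeg.
  by rewrite [leqRHS]big_mkcond leq_sum // => i _; case: eqP => [->|].
rewrite (bigD1 (BMultinom mdeg_lt)) //= mcoeffX eqxx big1 ?addr0 // => k.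
case/andP=> _; rewrite mcoeffX -val_eqE /=.
by case: eqP.
Qed.

Lemma mcoeff_zero_last (n : nat) (p : {mpoly int[n.+1]}) (m : 'X_{1..n}) :
  (zero_last p)@_m
    = p@_[multinom (if unlift ord_max i is Some j then m j else 0%N)
            | i < n.+1].
Proof.
set m' := [multinom _ | _ < _].
have lastX k : zero_last 'X_[k] =
    (k ord_max == 0%N)%:R *: 'X_[[multinom k (lift ord_max i) | i < n]].
  rewrite /zero_last comp_mpolyX (bigD1_ord ord_max) //= tnth_mktuple.
  rewrite unlift_none expr0n.
  have [_|_] := eqVneq (k ord_max) 0%N; last by rewrite mul0r scale0r.
  rewrite mul1r scale1r mpolyXE_id; apply: eq_bigr => i _.
  by rewrite tnth_mktuple liftK mnmE.
rewrite {1}/zero_last comp_mpolyEX [X in _ = X@__]mpolyE.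
rewrite (raddf_sum (mcoeff m)) (raddf_sum (mcoeff m')) /=.
apply: eq_bigr => k _.
rewrite -/(zero_last _) lastX !mcoeffZ !mcoeffX -natrM mulnb.
congr (_ * _%:R); congr nat_of_bool; apply/andP/eqP => [[/eqP k0 /eqP km]|->].
  apply/mnmP => i; rewrite mnmE -km.
  by case: unliftP => [j|] ->; rewrite ?mnmE.
rewrite mnmE unlift_none; split=> //; apply/eqP/mnmP => i.
by rewrite !mnmE liftK.
Qed.

Fact monomial_symfun_subproof (la : seq nat) : is_symfun (monomial_sympoly la).
Proof.
split=> [n|n|].
- apply/issymP=> s; apply/mpolyP=> m; rewrite mcoeff_sym.
  rewrite !mcoeff_monomial_sympoly; congr (nat_of_bool _)%:R.
  apply: permPl; apply/perm_filter/tuple_permP; exists s.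
  by congr tval; apply/eq_mktuple.
- apply/mpolyP=> m; rewrite mcoeff_zero_last !mcoeff_monomial_sympoly.
  congr (nat_of_bool (perm_eq _ la))%:R.
  rewrite /= enum_ordSr map_rcons filter_rcons unlift_none /= -map_comp.
  rewrite (_ : tval m = [tuple m i | i < n]); last first.
    by congr tval; apply/eq_from_tnth=> i; rewrite tnth_mktuple.
  congr filter; apply: eq_map => i /=.
  rewrite (_ : widen_ord _ i = lift ord_max i) ?liftK //.
  by apply: val_inj; exact/esym/lift_max.
exists (sumn la).+1 => n; apply: (leq_trans (msize_sum _ _ _)).
by apply/bigmax_leqP => m _; rewrite msizeX; apply: bmdeg.
Qed.

Definition monomial_symfun (la : seq nat) : symfun :=
  SymFun (monomial_symfun_subproof la).

Lemma monomial_symfun_nil : monomial_symfun [::] = 1.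
Proof.
apply: symfunP => n; apply/mpolyP => m.
rewrite [LHS]mcoeff_monomial_sympoly [RHS]mcoeffC mul1r.
congr (nat_of_bool _)%:R; apply/idP/eqP => [/perm_nilP|->].
  move=> m0; apply/mnmP => i; rewrite mnm0E; apply/eqP/negPn/negP => mi.
  have : m i \in [seq j <- m | j != 0%N] by rewrite mem_filter mi mem_tnth.
  by rewrite m0.
apply/perm_nilP/eqP/negPn; rewrite -has_filter; apply/hasPn.
by move=> _ /tnthP[i ->]; rewrite -mnm_tnth mnm0E.
Qed.

Definition alg_independent (R : comNzRingType) (A : set R) : Prop :=
  forall (k : nat) (x : 'I_k -> R), injective x -> (forall i, A (x i)) ->
  forall P : {mpoly int[k]}, mmap intr x P = 0 -> P = 0.

(* In particular an algebraically independent set never contains the monomial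
   symmetric function of the empty partition. *)
Lemma alg_independent_notin1 (R : comNzRingType) (A : set R) :
  alg_independent A -> ~ A 1.
Proof.
move=> indA A1.
have : 'X_ord0 - 1 = 0 :> {mpoly int[1]}.
  apply: (indA 1%N (fun=> 1)) => [i j _| //|]; first by rewrite !ord1.
  by rewrite rmorphB rmorph1 /= mmapX mmap1U subrr.
move/(congr1 (mcoeff 0%MM)); rewrite mcoeffB mcoeffX mcoeff1 mcoeff0 eqxx.
by rewrite mnm1_eq0.
Qed.

(* Z-subalgebras are the same as subrings; classically, the boolean predicates
   [S] range over all subsets of [R]. *)
Definition generates (R : comNzRingType) (A : set R) : Prop :=
  forall S : {pred R}, GRing.subring_closed S ->
  (forall x, A x -> x \in S) -> forall x, x \in S.

(* Main.v *)
(* If every lambda^n is (1^n), the u_n are the elementary symmetric functions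
   and the fundamental theorem in finitely many variables passes to the limit,
   since a symmetric function of degree at most N is determined by its
   truncation to N variables.

   For the converse only generation is used.  Let z be a primitive n-th root of
   unity and evaluate in n variables at x_i = z^i T.  A homogeneous symmetric
   function of degree k goes to a multiple of T^k, which is zero when n does not
   divide k; so modulo T^(n+1) the ring generated by the u_k goes to elements
   a + b c T^n with a, b integers, where c is the value of m_{lambda^n} at the
   n-th roots of unity.  Since e_n goes to a unit times T^n, |b c| = 1 for some
   integer b.  On the other hand, summing over all permutations of the
   exponents, one computes G |c| = n (l-1)! (n-l)!, where l is the number of parts
   of lambda^n and G <= l! (n-l)! is the order of the stabilizer of the exponent
   vector.  Hence n (l-1)! (n-l)! <= G <= l! (n-l)!, so n <= l. *)

Require Import Defs.
From HB Require Import structures.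
From mathcomp Require Import all_boot all_fingroup all_order all_algebra.
From mathcomp Require Import all_field ring.
From mathcomp Require Import boolp classical_sets mpoly.

Set Implicit Arguments.
Unset Strict Implicit.
Unset Printing Implicit Defensive.

Import Order.TTheory GRing.Theory Num.Theory.
Local Open Scope ring_scope.

Local Notation e_ k := (monomial_symfun (nseq k 1%N)).
Local Notation "m # s" := [multinom m (s i) | i < _]
  (at level 40, left associativity, format "m # s").

(** * Elementary symmetric functions: truncation, generation and independence *)

Lemma sumn_filter_neq0 (n : nat) (m : 'X_{1..n}) :
  sumn [seq i <- m | i != 0%N] = mdeg m.
Proof.
rewrite sumnE big_filter /mdeg [RHS](bigID (fun i => i != 0%N)) /=.
by rewrite [X in (_ + X)%N]big1 ?addn0 // => i; rewrite negbK => /eqP.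
Qed.

Lemma monomial_sympoly_nseq1 (k n : nat) :
  monomial_sympoly (nseq k 1%N) n = mesym n int k.
Proof.
apply/mpolyP => m; rewrite mcoeff_monomial_sympoly mcoeff_mesym.
congr (nat_of_bool _)%:R; rewrite /mechar.
apply/idP/andP => [mk|[/eqP mk /forallP m1]].
  rewrite -sumn_filter_neq0 (perm_sumn mk) sumn_nseq mul1n; split=> //.
  apply/forallP => i; have [->//|mi] := eqVneq (m i) 0%N.
  have : m i \in [seq j <- m | j != 0%N] by rewrite mem_filter mi mem_tnth.
  by rewrite (perm_mem mk) mem_nseq => /andP[_ /eqP->].
have /all_pred1P sE : all (pred1 1%N) [seq i <- m | i != 0%N].
  apply/allP => j; rewrite mem_filter => /andP[j0 /tnthP[i ji]].
  by have := m1 i; rewrite mnm_tnth -ji /=; case: j j0 ji => [|[]].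
have := sumn_filter_neq0 m; rewrite mk sE sumn_nseq mul1n => <-.
exact: perm_refl.
Qed.

Definition truncate (n : nat) (f : symfun) : {mpoly int[n]} := f n.

Fact truncate_is_zmod_morphism n : zmod_morphism (truncate n).
Proof. by []. Qed.
Fact truncate_is_monoid_morphism n : monoid_morphism (truncate n).
Proof. by split=> //; apply: mpolyC1. Qed.
HB.instance Definition _ n := GRing.isZmodMorphism.Build symfun {mpoly int[n]}
  (truncate n) (truncate_is_zmod_morphism n).
HB.instance Definition _ n := GRing.isMonoidMorphism.Build symfun {mpoly int[n]}
  (truncate n) (truncate_is_monoid_morphism n).

Lemma truncate_elementary (k n : nat) : truncate n (e_ k) = mesym n int k.
Proof. exact: monomial_sympoly_nseq1. Qed.

Lemma mmap_compr (R : nzRingType) (S S' : comNzRingType)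
    (f : {rmorphism S -> S'}) (g : {rmorphism R -> S})
    (k : nat) (x : 'I_k -> S) (p : {mpoly R[k]}) :
  f (mmap g x p) = mmap (f \o g) (f \o x) p.
Proof.
rewrite /mmap rmorph_sum; apply: eq_bigr => m _ /=.
rewrite rmorphM; congr (_ * _); rewrite /mmap1 rmorph_prod.
by apply: eq_bigr => i _; rewrite rmorphXn.
Qed.

Lemma eq_mmap (R S : nzRingType) (f g : R -> S) (k : nat) (x y : 'I_k -> S) :
  f =1 g -> x =1 y -> mmap f x =1 mmap g y.
Proof.
by move=> fg xy p; apply: eq_bigr => m _; rewrite fg (mmap1_eq _ xy).
Qed.

Lemma truncate_mmap (k n : nat) (x : 'I_k -> symfun) (p : {mpoly int[k]}) :
  truncate n (mmap intr x p) = p \mPo [tuple truncate n (x i) | i < k].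
Proof.
rewrite mmap_compr; apply: eq_mmap => [c|i] /=; last by rewrite tnth_mktuple.
by rewrite rmorph_int -(rmorph_int (@mpolyC n int)) intz.
Qed.

(** Truncations below [N] arise from [f N] by setting variables to zero. Above [N], a monomial of
    degree at most [N] misses some variable; symmetry moves that variable to the last place, where
    [zero_last] preserves the coefficient, so induction on the number of variables applies. *)
Lemma symfun_eq0 (N : nat) (f : symfun) :
  (forall n m, (N < mdeg m)%N -> (f n)@_m = 0) -> f N = 0 -> f = 0.
Proof.
case: f => f fP /= degf fN; apply: symfunP => n /=; rewrite mpolyC0.
case: (fP) => symf zf _.
have down k : f (N - k)%N = 0.
  elim: k => [|k IHk]; first by rewrite subn0.
  have [kN|Nk] := ltnP k N; last first.
    by rewrite (eqP (leqW Nk : N - k.+1 == 0)%N) -(eqP (Nk : N - k == 0)%N).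
  by move: IHk; rewrite -(subnSK kN) => fk; rewrite -zf fk; apply: comp_mpoly0.
suff up k : f (N + k)%N = 0.
  have [Nn|/ltnW nN] := leqP N n; first by rewrite -(subnKC Nn).
  by rewrite -(subKn nN).
elim: k => [|k]; rewrite ?addn0 // addnS; move: (leq_addr k N).
move: (N + k)%N => {}n Nn fn; apply/mpolyP => m; rewrite mcoeff0.
have [Nm|mN] := ltnP N (mdeg m); first exact: degf.
have [i /eqP mi] : exists i, m i == 0%N.
  apply/existsP; apply: contraLR (leq_trans mN Nn) => /existsPn m0.
  rewrite -ltnNge mdegE -[leqLHS]card_ord -sum1_card leq_sum // => i _.
  by rewrite lt0n.
rewrite -(msym_coeff _ (tperm i ord_max)) //.
set m' := [multinom _ | _ < _].
have <- : (f n)@_[multinom m' (lift ord_max j) | j < n] = (f n.+1)@_m'.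
  rewrite -zf mcoeff_zero_last; congr (_@__); apply/mnmP => j.
  rewrite mnmE; case: unliftP => [l|] ->; rewrite ?mnmE //.
  by rewrite tpermR mi.
by rewrite fn mcoeff0.
Qed.

(** The variable of index [i] has weight [i.+1], the degree of [e_ i.+1], so the substitution turns
    weight into degree. As [mweight] is one more than the largest weight of a nonzero polynomial,
    the hypothesis puts every weight strictly below [mdeg m]. *)
Lemma truncate_degree_mmap (N n : nat) (p : {mpoly int[N]}) (m : 'X_{1..n}) :
  (mweight p <= mdeg m)%N ->
  (truncate n (mmap intr (fun i : 'I_N => e_ i.+1) p))@_m = 0.
Proof.
move=> pm; rewrite truncate_mmap /comp_mpoly /mmap raddf_sum /=.
rewrite big_seq big1 // => k kp; rewrite mcoeffCM.
suff /dhomog_nemf_coeff-> : mmap1 (tnth [tuple truncate n (e_ i.+1) | i < N]) k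
    \is (mnmwgt k).-homog; first by rewrite mulr0.
  rewrite gtn_eqF //; apply: leq_trans pm.
  rewrite mmeasureE.
  exact: (@leq_bigmax_seq _ (msupp p) xpredT (fun m => (mnmwgt m).+1)).
rewrite /mmap1 /mnmwgt; elim/big_rec2: _ => [|i d q _ hq]; first exact: dhomog1.
apply: dhomogM => //; rewrite mulnC; apply: dhomogMn.
rewrite tnth_mktuple truncate_elementary.
apply/dhomogP => m'; rewrite mem_msupp_mesym => /andP[/eqP //].
Qed.

(** Let [d] bound the sizes of all truncations of [f]. The fundamental theorem in [d] variables
    gives [p] of weight controlled by the same [d], so the difference of the two sides has no
    monomial of degree above [d] in any number of variables, and its vanishing in [d] variables
    suffices. *)
Lemma elementary_span (f : symfun) :
  exists N, exists p : {mpoly int[N]},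
    f = mmap intr (fun i : 'I_N => e_ i.+1) p.
Proof.
have [d fd] : exists d, forall n, (msize (f n) <= d)%N by case: (truncP f).
have [p [pf wp]] : {p | p \mPo [tuple mesym d int i.+1 | i < d] = f d
    /\ (mweight p <= msize (f d))%N}.
  by apply: sym_fundamental; case: (truncP f).
exists d, p; apply/eqP; rewrite -subr_eq0; apply/eqP.
apply: (@symfun_eq0 d) => [n m dm|].
  rewrite -/(truncate n _) rmorphB mcoeffB truncate_degree_mmap ?subr0.
    apply/eqP; rewrite mcoeff_eq0; apply: contraL dm => /msize_mdeg_lt.
    by rewrite -leqNgt => /leq_trans/(_ (fd n))/ltnW.
  by apply: leq_trans (ltnW dm); apply: leq_trans wp (fd d).
rewrite -/(truncate d _) rmorphB /= truncate_mmap /truncate -pf.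
apply/eqP; rewrite subr_eq0; apply/eqP; apply: eq_mmap => // i.
by rewrite !tnth_mktuple -truncate_elementary.
Qed.

Lemma subring_closed_mmap (R : comNzRingType) (S : {pred R}) (k : nat)
    (x : 'I_k -> R) (p : {mpoly int[k]}) :
  GRing.subring_closed S -> (forall i, x i \in S) -> mmap intr x p \in S.
Proof.
case=> S1 SB SM Sx.
have S0 : 0 \in S by rewrite -(subrr 1) SB.
have SN y : y \in S -> - y \in S by move=> Sy; rewrite -[- y]add0r SB.
have SD y z : y \in S -> z \in S -> y + z \in S.
  by move=> Sy Sz; rewrite -[z]opprK SB ?SN.
have Sn n : 1 *+ n \in S by elim: n => [|n IHn]; rewrite ?mulrS ?SD.
rewrite /mmap; apply: (big_ind (fun y => y \in S)) => // m _; apply: (SM).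
  by case: (p@_m) => n; [apply: Sn | apply/SN/Sn].
rewrite /mmap1; apply: (big_ind (fun y => y \in S)) => // i _.
by elim: (m i) => // j; rewrite exprS; apply: SM.
Qed.

Lemma elementary_generates (A : set symfun) :
  (forall n, A (e_ n)) -> generates A.
Proof.
move=> Ae S Sring SA f; have [N [p ->]] := elementary_span f.
by apply: subring_closed_mmap => // i; apply/SA/Ae.
Qed.

Lemma elementary_alg_independent :
  alg_independent [set e_ n | n in [set n | (0 < n)%N]]%classic.
Proof.
move=> k x inj_x xe P P0.
have /choice[r xr] : forall i, exists n, x i = e_ n.+1.
  by move=> i; have [[|n] // _ <-] := xe i; exists n.
(* [N] variables suffice for all the elementary functions that occur; [q] is [P] with its variables
   renamed along the injection [rho], so that independence in [N] variables applies. *)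
pose N := (\max_i r i).+1; pose rho i : 'I_N := inord (r i).
have rhoE i : rho i = r i :> nat by rewrite inordK // ltnS leq_bigmax.
have inj_rho : injective rho.
  move=> i j /(congr1 val) /=; rewrite !rhoE => rij.
  by apply: inj_x; rewrite !xr rij.
pose q := P \mPo [tuple 'X_(rho i) | i < k].
have q0 : q = 0.
  apply: msym_fundamental_un0; rewrite /q /comp_mpoly mmap_compr /=.
  have <- : truncate N (mmap intr x P) = 0 by rewrite P0 raddf0.
  rewrite truncate_mmap; apply: eq_mmap => [c|i] /=.
    by rewrite mmapC.
  rewrite !tnth_mktuple mmapX mmap1U tnth_mktuple rhoE xr.
  by rewrite truncate_elementary.
pose back (j : 'I_N) : {mpoly int[k]} :=
  if [pick i | rho i == j] is Some i then 'X_i else 0.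
have : q \mPo [tuple back j | j < N] = 0 by rewrite q0 comp_mpoly0.
rewrite /q /comp_mpoly mmap_compr => <-; rewrite -[LHS]comp_mpoly_id.
apply: eq_mmap => [c|i] /=; first by rewrite mmapC.
rewrite !tnth_mktuple mmapX mmap1U tnth_mktuple /back.
by case: pickP => [j /eqP/inj_rho->//|/(_ i)]; rewrite eqxx.
Qed.

(** * Sums over permutations of exponents at the roots of unity *)

Definition mnm_support (n : nat) (m : 'X_{1..n}) : {set 'I_n} :=
  [set i | m i != 0%N].

Definition mnm_stabilizer (n : nat) (m : 'X_{1..n}) : {set 'S_n} :=
  [set s : 'S_n | m#s == m].

Lemma sum_prim_root_eq0 (F : fieldType) (n a : nat) (z : F) :
  n.-primitive_root z -> ~~ (n %| a)%N -> \sum_(i < n) z ^+ (a * i) = 0.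
Proof.
move=> zn; rewrite (prim_order_dvd zn) -subr_eq0 => za.
apply: (mulfI za); rewrite mulr0 (eq_bigr (fun i : 'I_n => (z ^+ a) ^+ i)).
  by rewrite -subrX1 -exprM mulnC exprM (prim_expr_order zn) expr1n subrr.
by move=> i _; rewrite exprM.
Qed.

Lemma card_mnm_support (n : nat) (m : 'X_{1..n}) :
  #|mnm_support m| = size [seq i <- m | i != 0%N].
Proof.
rewrite size_filter -sum1_count big_tuple -sum1_card.
by apply: eq_bigl => i; rewrite inE.
Qed.

(** This is the permanent of the matrix with entries [z ^+ (m i * j)]. *)
Definition permsum (R : nzRingType) (z : R) (n : nat) (m : 'X_{1..n}) : R :=
  \sum_(s : 'S_n) \prod_(i < n) z ^+ (m i * s i).

Lemma permsum_mperm (R : comNzRingType) (z : R) (n : nat) (m : 'X_{1..n})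
    (t : 'S_n) :
  permsum z (m#t) = permsum z m.
Proof.
rewrite /permsum (reindex_inj (mulgI t)) /=; apply: eq_bigr => s _.
rewrite [RHS](reindex_inj (@perm_inj _ t)) /=; apply: eq_bigr => i _.
by rewrite mnmE permM.
Qed.

(** For a fixed permutation [s], adding [a] at position [i] multiplies the product by
    [z ^+ (a * s i)]; summed over [i], these factors give the power sum of all [n]-th roots of
    unity. *)
Lemma sum_permsum_eq0 (F : fieldType) (z : F) (n a : nat) (m : 'X_{1..n}) :
  n.-primitive_root z -> ~~ (n %| a)%N ->
  \sum_i permsum z (m + U_(i) *+ a) = 0.
Proof.
move=> zn na; rewrite exchange_big big1 //= => s _.
transitivity (\sum_(i < n) (\prod_j z ^+ (m j * s j)) * z ^+ (a * s i)).
  apply: eq_bigr => i _; rewrite (bigD1 i) //= [in RHS](bigD1 i) //=.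
  rewrite mnmDE mulmnE mnm1E eqxx mul1n mulnDl exprD -!mulrA.
  congr (_ * _); rewrite mulrC; congr (_ * _); apply: eq_bigr => j ji.
  by rewrite mnmDE mulmnE mnm1E eq_sym (negPf ji) addn0.
rewrite -mulr_sumr -[RHS](mulr0 (\prod_j z ^+ (m j * s j))); congr (_ * _).
by rewrite -[RHS](sum_prim_root_eq0 zn na) [RHS](reindex_inj (@perm_inj _ s)).
Qed.

(* Take a part a = m j off position j and put it back at each position in turn:
   the n sums so obtained add up to 0, because the a-th powers of the n-th roots
   of unity do.  On an empty position this gives a permutation of m, on an
   occupied one it merges two parts, whence the induction on their number. *)
Lemma permsumE (F : numFieldType) (z : F) (n k : nat) (m : 'X_{1..n}) :
    n.-primitive_root z -> mdeg m = n -> #|mnm_support m| = k.+1 ->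
  permsum z m = (-1) ^+ k * (k`! * n * (n - k.+1)`!)%:R.
Proof.
move=> zn; elim: k m => [|k IHk] m degm.
  move/eqP/cards1P=> [j suppm].
  have m0 i : i != j -> m i = 0%N.
    move=> ij; apply/eqP; have /setP/(_ i) := suppm.
    by rewrite !inE (negPf ij) => /negbFE.
  have mj : m j = n.
    by rewrite -[RHS]degm mdegE (bigD1 j) //= big1 ?addn0 // => i /m0.
  rewrite mul1r mul1n /permsum (eq_bigr (fun=> 1)) => [|s _].
    rewrite sumr_const card_Sn; congr _%:R; rewrite subn1.
    by rewrite -(ltn_predK (ltn_ord j)).
  rewrite (bigD1 j) //= big1 => [|i /m0-> //].
  by rewrite mulr1 mj exprM (prim_expr_order zn) expr1n.
move=> cardm; have [j mj] : exists j, j \in mnm_support m.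
  by apply/set0Pn; rewrite -card_gt0 cardm.
pose a := m j; pose m' := (m - U_(j) *+ a)%MM.
have m'E i : m' i = if i == j then 0%N else m i.
  rewrite mnmBE mulmnE mnm1E eq_sym; case: eqVneq => [->|_].
    by rewrite mul1n subnn.
  by rewrite subn0.
have suppm' : mnm_support m' = mnm_support m :\ j.
  by apply/setP => i; rewrite !inE m'E; case: (i == j).
have cardm' : #|mnm_support m'| = k.+1.
  by have := cardsD1 j (mnm_support m); rewrite cardm mj suppm' => -[->].
have mE : m = (m' + U_(j) *+ a)%MM.
  rewrite submK //; apply/mnm_lepP => i; rewrite mulmnE mnm1E.
  by case: eqVneq => [<-|]; rewrite ?mul1n.
have degm' : (mdeg m' + a = n)%N.
  by rewrite -[RHS]degm mE mdegD mdegMn mdeg1 mul1n.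
have a_gt0 : (0 < a)%N by rewrite lt0n; move: mj; rewrite inE.
(* Another part remains in [m'], so [a] is less than [n] and not divisible by it. *)
have a_ltn : (a < n)%N.
  have [i m'i] : exists i, i \in mnm_support m'.
    by apply/set0Pn; rewrite -card_gt0 cardm'.
  rewrite -degm' -[ltnLHS]add0n ltn_add2r mdegE (bigD1 i) //= addn_gt0 lt0n.
  by move: m'i; rewrite inE => ->.
have k_ltn : (k.+1 < n)%N by rewrite -cardm -[leqRHS]card_ord max_card.
have := sum_permsum_eq0 m' zn (negbT (gtnNdvd a_gt0 a_ltn)).
rewrite (bigID (mem (mnm_support m'))) /=.
rewrite (eq_bigr (fun=> (-1) ^+ k * (k`! * n * (n - k.+1)`!)%:R)) => [|i m'i].
  rewrite sumr_const cardm'.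
  rewrite [X in _ + X](eq_bigr (fun=> permsum z m)) => [|i m'i].
    rewrite sumr_const (_ : #|_| = (n - k.+2).+1); last first.
      have := cardC (mem (mnm_support m')); rewrite cardm' card_ord => e.
      by apply: (@addnI k.+1); rewrite -addSnnS subnKC //; apply: e.
    rewrite -(subnSK k_ltn).
    move=> /eqP; rewrite addrC addr_eq0 => /eqP B.
    have /mulfI : (n - k.+2).+1%:R != 0 :> F by rewrite pnatr_eq0.
    apply; rewrite mulr_natl B !factS !natrM exprS; ring.
  rewrite -(permsum_mperm z m (tperm i j)); congr permsum; apply/mnmP => l.
  move: m'i; rewrite inE negbK => /eqP m'i.
  rewrite mnmDE mulmnE mnm1E mnmE.
  case: tpermP => [->|->|/eqP li /eqP lj].
  - by rewrite eqxx mul1n m'i.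
  - rewrite m'E eqxx; case: (eqVneq i j) => [->|ij]; first by rewrite mul1n.
    by move: m'i; rewrite m'E (negPf ij).
  by rewrite eq_sym (negPf li) addn0 m'E (negPf lj).
apply: IHk.
  by rewrite mdegD mdegMn mdeg1 mul1n.
rewrite -cardm'; apply: eq_card => l; rewrite !inE mnmDE mulmnE mnm1E.
case: (eqVneq i l) => [<-|_]; last by rewrite addn0.
by move: m'i; rewrite inE addn_eq0 negb_and => ->.
Qed.

(** * Stabilizers and orbits of exponent vectors *)

Lemma card_mnm_stabilizer_le (n : nat) (m : 'X_{1..n}) :
  (#|mnm_stabilizer m|
     <= (#|mnm_support m|)`! * (n - #|mnm_support m|)`!)%N.
Proof.
set A := mnm_support m.
have stabA s : s \in mnm_stabilizer m ->
    s \in 'N(A | 'P)%g /\ s \in 'N(~: A | 'P)%g.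
  rewrite inE => /eqP/mnmP ms; rewrite astabsC; split; apply/astabsP => i /=;
    by rewrite !inE apermE -[in RHS]ms mnmE.
(* A permutation fixing [m] preserves the support and its complement, hence is determined by its two
   restrictions. *)
pose f (s : 'S_n) := (restr_perm A s, restr_perm (~: A) s).
have inj_f : {in mnm_stabilizer m &, injective f}.
  move=> s t /stabA[sA sA'] /stabA[tA tA'] [fA fA']; apply/permP => i.
  have [iA|iA] := boolP (i \in A).
    by rewrite -(restr_permE sA iA) -(restr_permE tA iA) fA.
  have {}iA : i \in ~: A by rewrite inE.
  by rewrite -(restr_permE sA' iA) -(restr_permE tA' iA) fA'.
rewrite -(card_in_imset inj_f).
pose X := finset.setX [set s | perm_on A s] [set s | perm_on (~: A) s].
apply: (@leq_trans #|X|).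
  apply/subset_leq_card/fintype.subsetP => _ /imsetP[s _ ->].
  rewrite finset.in_setX; apply/andP.
  by split; rewrite finset.in_set; exact: restr_perm_on.
have cardS (B : {set 'I_n}) : #|[set s | perm_on B s]| = (#|B|)`!.
  by rewrite cardsE card_perm.
by rewrite cardsX !cardS [#|~: A|]cardsCs finset.setCK card_ord.
Qed.

Lemma perm_eq_filter_neq0 (n : nat) (m m' : 'X_{1..n}) :
  perm_eq [seq i <- m | i != 0%N] [seq i <- m' | i != 0%N] ->
  exists s : 'S_n, m' = m#s.
Proof.
move=> mm'; suff /tuple_permP[s ms] : perm_eq m' m.
  by exists s; apply/val_inj/val_inj; rewrite /= ms.
(* Both vectors have length [n], so equally many nonzero entries leave equally many zeros. *)
have zeros (k : 'X_{1..n}) : [seq i <- k | ~~ (i != 0%N)]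
    = nseq (n - size [seq i <- k | i != 0%N]) 0%N.
  have /all_pred1P -> : all (pred1 0%N) [seq i <- k | ~~ (i != 0%N)].
    by apply/allP => i; rewrite mem_filter negbK => /andP[].
  congr nseq; rewrite !size_filter.
  have := count_predC (fun i => i != 0%N) k; rewrite size_tuple => e.
  by rewrite -[X in (X - _)%N]e addKn.
rewrite perm_sym -(permPl (permEl (perm_filterC (fun i => i != 0%N) m))).
rewrite -(permPr (permEl (perm_filterC (fun i => i != 0%N) m'))).
by rewrite perm_cat // /predC /= !zeros (perm_size mm').
Qed.

Lemma filter_mperm (n : nat) (m : 'X_{1..n}) (s : 'S_n) :
  perm_eq [seq i <- m#s | i != 0%N] [seq i <- m | i != 0%N].
Proof.
apply/perm_filter/tuple_permP; exists s.
by congr tval; apply/eq_mktuple.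
Qed.

(** Orbit counting: the orbit of [m] consists of the monomials of type [la], and each is reached by
    a coset of the stabilizer. *)
Lemma sum_mpolyX_mperm (n : nat) (la : seq nat) (m : 'X_{1..n}) :
  perm_eq [seq i <- m | i != 0%N] la ->
  \sum_(s : 'S_n) 'X_[m#s] = monomial_sympoly la n *+ #|mnm_stabilizer m|.
Proof.
move=> mla; apply/mpolyP => m'; rewrite raddf_sum mcoeffMn.
rewrite mcoeff_monomial_sympoly /=.
under eq_bigr do rewrite mcoeffX.
have [m'la|m'la] := boolP (perm_eq _ la); last first.
  rewrite mul0rn big1 // => s _; case: eqP => // mm'.
  by move: m'la; rewrite -mm' (permPl (filter_mperm m s)) mla.
have [|t ->] := @perm_eq_filter_neq0 _ m m'.
  by rewrite (permPl mla) perm_sym.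
rewrite (reindex_inj (mulgI t)) /= -natr_sum; congr _%:R.
rewrite -sum1_card [RHS]big_mkcond; apply: eq_bigr => s _ /=.
by rewrite mpermM (inj_eq (@mperm_inj _ t)) inE; case: eqP.
Qed.

Lemma permsum_stabilizer (R : comNzRingType) (z : R) (n : nat) (la : seq nat)
    (m : 'X_{1..n}) :
  perm_eq [seq i <- m | i != 0%N] la ->
  permsum z m = mmap intr (fun i : 'I_n => z ^+ i) (monomial_sympoly la n)
    *+ #|mnm_stabilizer m|.
Proof.
move=> mla; rewrite -raddfMn /= -(sum_mpolyX_mperm mla) raddf_sum /=.
rewrite /permsum (reindex_inj invg_inj) /=; apply: eq_bigr => s _.
rewrite mmapX /mmap1 (reindex_inj (@perm_inj _ s)) /=; apply: eq_bigr => i _.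
by rewrite permK mnmE -exprM mulnC.
Qed.

(** * Homogeneous polynomials at the roots of unity *)

Lemma mmap_polyX_homog (R : comNzRingType) (n d : nat) (x : 'I_n -> R)
    (p : {mpoly int[n]}) :
  p \is d.-homog ->
  mmap intr (fun i => (x i)%:P * 'X) p = (mmap intr x p)%:P * 'X^d.
Proof.
move=> /dhomogP hp; rewrite /mmap big_seq [in RHS]big_seq rmorph_sum mulr_suml.
apply: eq_bigr => m /hp md; rewrite rmorphM rmorph_int -mulrA; congr (_ * _).
rewrite /mmap1 -md /= mdegE -prodrXr rmorph_prod -big_split.
by apply: eq_bigr => i _ /=; rewrite exprMn rmorphXn.
Qed.

Lemma mmap_homogZ (R : comNzRingType) (n d : nat) (c : R) (x : 'I_n -> R)
    (p : {mpoly int[n]}) :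
  p \is d.-homog ->
  mmap intr (fun i => c * x i) p = c ^+ d * mmap intr x p.
Proof.
move=> /dhomogP hp; rewrite /mmap big_seq [in RHS]big_seq mulr_sumr.
apply: eq_bigr => m /hp md; rewrite mulrCA; congr (_ * _).
rewrite /mmap1 -md /= mdegE -prodrXr -big_split.
by apply: eq_bigr => i _; rewrite exprMn.
Qed.

(* Multiplication by z permutes the n-th roots of unity cyclically. *)
Lemma mmap_prim_root_eq0 (F : fieldType) (n d : nat) (z : F)
    (p : {mpoly int[n]}) :
    n.-primitive_root z -> ~~ (n %| d)%N ->
    p \is symmetric -> p \is d.-homog ->
  mmap intr (fun i : 'I_n => z ^+ i) p = 0.
Proof.
move=> zn; rewrite (prim_order_dvd zn) -subr_eq0 => zd sp hp.
apply: (mulfI zd); rewrite mulr0 mulrBl mul1r -(mmap_homogZ _ _ hp).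
apply/eqP; rewrite subr_eq0; apply/eqP.
rewrite -{2}(issymP _ sp (perm (@ordS_inj n))) /msym mmap_compr.
apply: eq_mmap => [c|i] /=; first by rewrite mmapC.
by rewrite mmapX mmap1U permE /= (prim_expr_mod zn) exprS.
Qed.

Lemma monomial_sympoly_homog (la : seq nat) (n : nat) :
  monomial_sympoly la n \is (sumn la).-homog.
Proof.
apply/dhomogP => m; rewrite mcoeff_msupp mcoeff_monomial_sympoly.
by case: (boolP (perm_eq _ la)) => // /perm_sumn <- _; rewrite sumn_filter_neq0.
Qed.

(** * Partitions as exponent vectors *)

Lemma size_le_sumn (la : seq nat) : 0%N \notin la -> (size la <= sumn la)%N.
Proof.
elim: la => //= a la IHla; rewrite inE negb_or eq_sym -lt0n => /andP[a0 /IHla].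
exact: (@leq_add 1).
Qed.

Lemma size_eq_sumn (la : seq nat) :
  0%N \notin la -> size la = sumn la -> la = nseq (size la) 1%N.
Proof.
elim: la => //= a la IHla; rewrite inE negb_or eq_sym -lt0n => /andP[a0 la0] e.
have := size_le_sumn la0; move: a0 e; case: a => [|[|a]] // _.
  by rewrite add1n => -[/(IHla la0) laE _]; congr cons.
by rewrite addSn => -[->]; rewrite addSn ltnNge leq_addl.
Qed.

Lemma partition_exponent (n : nat) (la : seq nat) : is_partition n la ->
  exists m : 'X_{1..n}, [seq i <- m | i != 0%N] = la.
Proof.
case/and3P => _ la0 /eqP nla.
have sla : (size la <= n)%N by rewrite -nla size_le_sumn.
(* The default value 0 of [nth] pads the partition with empty positions. *)
exists [multinom nth 0%N la i | i < n].
rewrite /= -[RHS](mkseq_nth 0%N) -[RHS]filter_predT.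
have -> : [seq nth 0%N la (i : 'I_n) | i <- enum 'I_n] = mkseq (nth 0%N la) n.
  by rewrite /mkseq -val_enum_ord -map_comp.
rewrite /mkseq -(subnKC sla) iotaD map_cat filter_cat.
rewrite [X in _ ++ X](_ : _ = [::]) ?cats0.
  apply: eq_in_filter => i; rewrite -/(mkseq _ _) mkseq_nth => il /=.
  by apply: contraNneq la0 => <-.
apply/eqP; rewrite -(negbK (_ == _)) -has_filter; apply/hasPn => i.
case/mapP => j; rewrite mem_iota => /andP[lj _] ->.
by rewrite nth_default.
Qed.

(** [G] is the order of the stabilizer. The permutation sum is evaluated twice, by [permsumE] and as
    [G] times the value of the monomial function; the norm removes the sign. *)
Lemma monomial_sympoly_prim_root (F : numFieldType) (z : F) (n : nat)
    (la : seq nat) :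
    (0 < n)%N -> n.-primitive_root z -> is_partition n la ->
  exists G, (G <= (size la)`! * (n - size la)`!)%N /\
    `|mmap intr (fun i : 'I_n => z ^+ i) (monomial_sympoly la n)| * G%:R
      = ((size la).-1`! * n * (n - size la)`!)%:R.
Proof.
move=> n0 zn la_n; have [m mla] := partition_exponent la_n.
exists #|mnm_stabilizer m|; split.
  by have := card_mnm_stabilizer_le m; rewrite card_mnm_support mla.
have degm : mdeg m = n.
  by rewrite -sumn_filter_neq0 mla; case/and3P: la_n => _ _ /eqP.
have la0 : (0 < size la)%N.
  rewrite lt0n; apply: contraTneq n0 => /size0nil la0.
  by rewrite -degm -sumn_filter_neq0 mla la0.
have := @permsumE _ z n (size la).-1 m zn degm; rewrite card_mnm_support mla.
rewrite prednK // => /(_ erefl).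
rewrite (@permsum_stabilizer _ _ _ la); last by rewrite mla.
move/(congr1 Num.norm); rewrite normrM normrX normrN1 expr1n mul1r normr_nat.
by rewrite normrMn mulr_natr.
Qed.

(** * Generation forces every part to be 1 *)

Lemma generates_eq_nseq1 (la : nat -> seq nat) :
  graded_partition_sequence la ->
  generates [set monomial_symfun (la k) | k in [set: nat]]%classic ->
  forall n, la n = nseq n 1%N.
Proof.
move=> la_part gen_la n.
have la0 : la 0%N = [::].
  have /and3P[_ /size_le_sumn + /eqP s0] := la_part 0%N.
  by rewrite s0 leqn0 => /eqP/size0nil.
have [->|n_gt0] := posnP n; first exact: la0.
have [z zn] := C_prim_root_exists n_gt0.
pose ev (p : {mpoly int[n]}) : algC := mmap intr (fun i : 'I_n => z ^+ i) p.
pose phi (f : symfun) : {poly algC} :=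
  mmap intr (fun i : 'I_n => (z ^+ i)%:P * 'X) (truncate n f).
pose c : algC := ev (monomial_sympoly (la n) n).
have phi_mono mu :
    phi (monomial_symfun mu) = (ev (monomial_sympoly mu n))%:P * 'X^(sumn mu).
  exact/mmap_polyX_homog/monomial_sympoly_homog.
pose S : {pred symfun} := fun f => `[< exists a b : int, exists q : {poly algC},
  phi f = a%:~R + (b%:~R * c)%:P * 'X^n + q * 'X^(n.+1) >].
have S_ring : GRing.subring_closed S.
  split.
  - apply/asboolP; exists 1, 0, 0.
    by rewrite /phi !rmorph1 !mul0r !addr0.
  - move=> f g /asboolP[a [b [q fE]]] /asboolP[a' [b' [q' gE]]].
    apply/asboolP; exists (a - a'), (b - b'), (q - q').
    rewrite /phi !rmorphB /= -/(phi f) -/(phi g) fE gE.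
    rewrite !mulrBl !rmorphB /=; ring.
  - move=> f g /asboolP[a [b [q fE]]] /asboolP[a' [b' [q' gE]]].
    apply/asboolP; exists (a * a'), (a * b' + a' * b).
    (* The remainder of the product; since [n] is positive, the product of the two middle terms, of
       degree [n + n], is absorbed as ['X^(n.-1)] times ['X^(n.+1)]. *)
    exists (a%:~R * q' + a'%:~R * q
      + ((b%:~R * c) * (b'%:~R * c))%:P * 'X^(n.-1)
      + ((b%:~R * c)%:P * q' + (b'%:~R * c)%:P * q) * 'X^n
      + q * q' * 'X^(n.+1)).
    rewrite /phi !rmorphM /= -/(phi f) -/(phi g) fE gE.
    rewrite !(mulrDl, rmorphD, rmorphM) /= !rmorph_int exprS.
    have -> : 'X^n = 'X * 'X^(n.-1) :> {poly algC} by rewrite -exprS prednK.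
    ring.
have S_la k : monomial_symfun (la k) \in S.
  have /and3P[_ _ /eqP sla] := la_part k.
  (* Below [n] the image is 0, or 1 when [k] is 0; above [n] it lies in the remainder; at [n] it is
     exactly the middle term with [b] equal to 1. *)
  have [kn|nk|kn] := ltngtP k n.
  - have [k0|k_gt0] := posnP k.
      by rewrite k0 la0 monomial_symfun_nil; case: S_ring.
    apply/asboolP; exists 0, 0, 0; rewrite phi_mono sla /ev.
    rewrite (@mmap_prim_root_eq0 _ _ k) //.
    + by rewrite !mul0r !addr0.
    + by rewrite gtnNdvd.
    + by case: (truncP (monomial_symfun (la k))) => /(_ n).
    + by rewrite -[k in k.-homog]sla monomial_sympoly_homog.
  - apply/asboolP; exists 0, 0.
    exists ((ev (monomial_sympoly (la k) n))%:P * 'X^(k - n.+1)).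
    by rewrite phi_mono sla -mulrA -exprD subnK // !mul0r !add0r.
  apply/asboolP; exists 0, 1, 0.
  by rewrite phi_mono sla kn mul1r mul0r addr0 add0r.
have /asboolP[a [b [q]]] : e_ n \in S.
  by apply: gen_la S_ring _ _ => _ [k _ <-].
rewrite phi_mono sumn_nseq mul1n -(rmorph_int (@polyC algC) a).
(* At degree [n > 0] the constant [a] does not contribute. *)
move/(congr1 (fun p : {poly algC} => p`_n)).
rewrite !coefD !coefMXn ltnn ltnSn subnn !coefC eqxx (gtn_eqF n_gt0).
rewrite addr0 add0r => /(congr1 Num.norm) bc.
have [G [G_le cG]] := monomial_sympoly_prim_root n_gt0 zn (la_part n).
have /and3P[_ la_n0 /eqP la_n] := la_part n.
(* The value of [e_ n] is the product of all [n]-th roots of unity, of modulus 1. *)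
have bc1 : `|b%:~R| * `|c| = 1 :> algC.
  have z1 : `|z| = 1.
    apply/eqP; rewrite -(pexpr_eq1 n_gt0) // -normrX (prim_expr_order zn).
    by rewrite normr1.
  rewrite -normrM -bc /ev monomial_sympoly_nseq1 mesymnnE rmorph_prod.
  rewrite normr_prod big1 // => i _.
  by rewrite /= mmapX mmap1U normrX z1 expr1n.
(* Multiplication by the modulus of [b] cancels that of [c] and leaves an identity of natural
   numbers. *)
have {cG} cG : `|b|%N * ((size (la n)).-1`! * n * (n - size (la n))`!) = G.
  apply/eqP; rewrite -(eqr_nat algC) natrM natr_absz intr_norm -cG mulrA bc1.
  by rewrite mul1r.
have b_gt0 : (0 < `|b|)%N.
  rewrite absz_gt0; apply: contraPneq bc1 => ->.
  by rewrite normr0 mul0r => /esym/eqP; rewrite oner_eq0.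
have l_gt0 : (0 < size (la n))%N.
  by rewrite lt0n; apply: contraTneq n_gt0 => /size0nil laE; rewrite -la_n laE.
have l_le : (size (la n) <= n)%N by rewrite -[leqRHS]la_n size_le_sumn.
suff nl : size (la n) = n by rewrite [LHS]size_eq_sumn ?nl ?la_n.
apply/eqP; rewrite eqn_leq l_le /=.
have : ((size (la n)).-1`! * n * (n - size (la n))`!
    <= (size (la n))`! * (n - size (la n))`!)%N.
  by apply: leq_trans G_le; rewrite -cG leq_pmull.
rewrite leq_pmul2r ?fact_gt0 // -[X in (_ <= X`!)%N](prednK l_gt0) factS.
rewrite prednK //.
by rewrite mulnC leq_pmul2r ?fact_gt0.
Qed.

Local Open Scope classical_set_scope.

Theorem theorem3p4 (lambda : nat -> seq nat)
    (hlambda : graded_partition_sequence lambda)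
    (u : nat -> symfun) (hu : forall n, u n = monomial_symfun (lambda n)) :
  (alg_independent (u @` [set n | (0 < n)%N]) /\ generates (range u))
  <-> (forall n, lambda n = nseq n 1%N).
Proof.
have -> : u = fun n => monomial_symfun (lambda n) by apply/funext.
split=> [[_ gen_u]|lambda1]; first exact: generates_eq_nseq1.
have -> : lambda = fun n => nseq n 1%N by apply/funext.
split; first exact: elementary_alg_independent.
by apply: elementary_generates => n; exists n.
Qed.
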